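(* Let $r$ be a fixed positive integer and $\beta$ a fixed real number. For each $n$, let $L_n^r=\{(a_1,\dots,a_r)\in\mathbb{Z}^r : 0\le a_i\le n-1 \text{ for all } i\}$ with the $\ell_1$ metric $\rho(a,b)=\sum_i|a_i-b_i|$, let $f_n(d)=\frac{1}{n^\beta d}$, and let $G=G(L_n^r,f_n)$. Then: (1) if $\beta<r-1$, then $G$ is connected asymptotically almost surely; (2) if $\beta>r-1$, then $G$ is disconnected asymptotically almost surely, and moreover there is a function $h$ with $h(n)\to0$ such that asymptotically almost surely $G$ has at least $n^r(1-h(n))$ isolated vertices.
   Context: $G(L_n^r,f_n)$ is the random graph with vertex set $L_n^r$ in which each pair of distinct vertices $u,v$ is joined by an edge independently with probability $\min\{1,f_n(\rho(u,v))\}$. ''Asymptotically almost surely'' means with probability tending to $1$ as $n\to\infty$. *)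

(* Defs.v *)
From HB Require Import structures.
From mathcomp Require Import all_boot all_order all_algebra.
From mathcomp Require Import all_classical all_reals all_analysis.
Import Order.TTheory GRing.Theory Num.Theory.
Import numFieldNormedType.Exports.

Set Implicit Arguments.
Unset Strict Implicit.
Unset Printing Implicit Defensive.

Local Open Scope ring_scope.

Definition simple_rel (V : finType) (E : {set V * V}) : bool :=
  [forall u, (u, u) \notin E] &&
  [forall u, forall v, ((u, v) \in E) == ((v, u) \in E)].

Record sgraph (V : finType) := SGraph {
  sgraph_rel :> {set V * V};
  _ : simple_rel sgraph_rel }.

HB.instance Definition _ (V : finType) := [isSub for @sgraph_rel V].
HB.instance Definition _ (V : finType) := [Finite of sgraph V by <:].

Definition adj (V : finType) (G : sgraph V) : rel V := fun u v => (u, v) \in G.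

Definition connected_graph (V : finType) (G : sgraph V) : bool :=
  [forall u, forall v, connect (adj G) u v].

Definition isolated_vertices (V : finType) (G : sgraph V) : {set V} :=
  [set u | [forall v, ~~ adj G u v]].

(* Each unordered pair of distinct vertices is represented by its ordering that
   is increasing for the enumeration of V. *)
Definition is_pair (V : finType) : pred (V * V) :=
  fun e => (enum_rank e.1 < enum_rank e.2)%N.

(* Law of the graph whose edges {u, v} are present independently with
   probability p u v, for p symmetric with values in [0, 1]. *)
Definition graph_weight (R : realType) (V : finType) (p : V -> V -> R)
    (G : sgraph V) : R :=
  \prod_(e | is_pair e)
    (if adj G e.1 e.2 then p e.1 e.2 else 1 - p e.1 e.2).

Definition graph_prob (R : realType) (V : finType) (p : V -> V -> R)
    (A : pred (sgraph V)) : R :=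
  \sum_(G : sgraph V | A G) graph_weight p G.

Lemma sum_prod_graph (R : realType) (V : finType) (F : V * V -> bool -> R) :
  \sum_(G : sgraph V) \prod_(e | is_pair e) F e (adj G e.1 e.2) =
  \prod_(e | is_pair e) (F e true + F e false).
Proof.
under [RHS]eq_bigr => e _ do rewrite -(big_bool _ (F e)).
rewrite (big_distr_big false).
pose phi (f : {ffun V * V -> bool}) : {set V * V} :=
  [set e | (is_pair e && f e) || (is_pair (e.2, e.1) && f (e.2, e.1))].
have phiP f : simple_rel (phi f).
  apply/andP; split; first by apply/forallP=> u; rewrite inE /is_pair /= ltnn.
  by apply/forallP=> u; apply/forallP=> v; rewrite !inE /= orbC.
have asym (u v : V) : is_pair (u, v) -> is_pair (v, u) = false.
  by rewrite /is_pair /= => uv; rewrite ltnNge (ltnW uv).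
have tot (u v : V) : u != v -> ~~ is_pair (u, v) -> is_pair (v, u).
  rewrite /is_pair /= -leqNgt leq_eqVlt => /negPf uv.
  by case/orP=> [/eqP/val_inj/enum_rank_inj/esym/eqP|//]; rewrite uv.
have phiE f e : is_pair e -> (e \in phi f) = f e.
  by case: e => u v uv; rewrite inE uv /= (asym _ _ uv) orbF.
pose psi (G : sgraph V) : {ffun V * V -> bool} :=
  [ffun e => is_pair e && adj G e.1 e.2].
rewrite [LHS](reindex_onto (fun f => SGraph (phiP f)) psi) /=; last first.
  move=> [E Es] _; apply: val_inj; apply/setP=> -[u v] /=.
  have /andP[/forallP irr /forallP sym] := Es.
  have {}sym x y : ((x, y) \in E) = ((y, x) \in E).
    by apply/eqP/(forallP (sym x)).
  rewrite inE !ffunE /adj /= [(v, u) \in E]sym.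
  have [<-|uv] := eqVneq u v; first by rewrite (negPf (irr u)) !andbF.
  have [/asym ->|/(tot _ _ uv) -> //] := boolP (is_pair (u, v)).
  by rewrite /= orbF.
apply: eq_big => [f|f _]; last first.
  by apply: eq_bigr => -[u v] uv; congr (F _ _); rewrite -[RHS]phiE.
apply/eqP/pffun_onP => [<-|[supp _]].
  by split => //; apply/fintype.subsetP => e; rewrite inE ffunE eqbF_neg negbK => /andP[].
apply/ffunP=> e; rewrite ffunE /adj /= -surjective_pairing.
have [/phiE ->//|ne] /= := boolP (is_pair e); apply/esym.
apply: contraNF ne => fe.
by apply: (fintype.subsetP supp); rewrite inE fe.
Qed.

Lemma graph_probT (R : realType) (V : finType) (p : V -> V -> R) :
  graph_prob p xpredT = 1.
Proof.
rewrite /graph_prob /graph_weight.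
rewrite (sum_prod_graph (fun e b => if b then p e.1 e.2 else 1 - p e.1 e.2)).
by apply: big1 => e _; rewrite addrC subrK.
Qed.

(* The edges are mutually independent and have the prescribed probabilities. *)
Lemma graph_prob_edges (R : realType) (V : finType) (p : V -> V -> R)
    (S : {set V * V}) (Spair : {subset S <= @is_pair V}) :
  graph_prob p (fun G => [forall e in S, adj G e.1 e.2]) =
  \prod_(e in S) p e.1 e.2.
Proof.
pose F e (b : bool) : R := if b then p e.1 e.2 else
  if e \in S then 0 else 1 - p e.1 e.2.
have -> : graph_prob p (fun G => [forall e in S, adj G e.1 e.2]) =
    \sum_(G : sgraph V) \prod_(e | is_pair e) F e (adj G e.1 e.2).
  rewrite /graph_prob big_mkcond; apply: eq_bigr => G _.
  case: ifPn => [/forall_inP SG|/forall_inPn[e eS eG]].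
    apply: eq_bigr => e _; rewrite /F; case: ifPn => // eG.
    by case: ifPn => // /SG; rewrite (negPf eG).
  by rewrite (bigD1 e) ?[is_pair e]Spair//= /F (negPf eG) eS mul0r.
rewrite sum_prod_graph (bigID (mem S)) /= [X in _ * X]big1 ?mulr1; last first.
  by move=> e /andP[_ /negPf eS]; rewrite /F eS addrC subrK.
apply: eq_big => e; first by apply/andP/idP => [[]//|eS]; split=> //; exact: Spair.
by move=> /andP[_ eS]; rewrite /F eS addr0.
Qed.

Definition edge_prob (R : realType) (V : finType) (rho : V -> V -> nat)
    (f : nat -> R) (u v : V) : R := Num.min 1 (f (rho u v)).

Definition lattice_box (r n : nat) : finType := {ffun 'I_r -> 'I_n}.

Definition l1_dist (r n : nat) (a b : lattice_box r n) : nat :=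
  (\sum_(i < r) `|(a i : nat)%:Z - (b i : nat)%:Z|)%N.

Lemma l1_distC (r n : nat) (a b : lattice_box r n) : l1_dist a b = l1_dist b a.
Proof. by apply: eq_bigr => i _; rewrite distnC. Qed.

Definition inv_dist_fun (R : realType) (beta : R) (n d : nat) : R :=
  (n%:R `^ beta * d%:R)^-1.

Definition lattice_prob (R : realType) (r : nat) (beta : R) (n : nat)
    (A : pred (sgraph (lattice_box r n))) : R :=
  graph_prob (edge_prob (@l1_dist r n) (inv_dist_fun beta n)) A.

Definition aas (R : realType) (r : nat) (beta : R)
    (A : forall n, pred (sgraph (lattice_box r n))) : Prop :=
  ((fun n => lattice_prob beta (A n)) @ \oo --> (1 : R))%classic.

(* Main.v *)
(* (1) Every edge has probability at least q = min(1, 1/(r n^(beta+1))). If G is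
   disconnected, some nonempty S with |S| <= N/2 (N = n^r) has no edge to its
   complement, which has probability at most exp(-q |S| (N - |S|)) <= x^|S| with
   x = exp(-q N / 2). Summing over all nonempty S gives
   (1 + x)^N - 1 <= exp(N x) - 1, and N x -> 0 because q N grows at least like a
   positive power of n.
   (2) If u and v differ in coordinate i then 1/rho(u, v) <= 1/|u_i - v_i|, so
   the expected degree of a vertex is at most
   n^(-beta) r n^(r-1) 2 (1 + ln n) = O(n^(-delta/2)) with
   delta = beta - (r - 1). Markov's inequality for the number of non-isolated
   vertices then allows h(n) = n^(-delta/4). *)
Require Import Defs.
From mathcomp Require Import all_boot all_order all_algebra.
From mathcomp Require Import all_classical all_reals all_analysis.
From mathcomp Require Import ring lra zify.
Import Order.TTheory GRing.Theory Num.Theory.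
Import numFieldNormedType.Exports.

Local Open Scope ring_scope.

(** * Elementary properties of the random graph law: monotonicity, union bound, single edges *)

Lemma graph_weight_ge0 (R : realType) (V : finType) (p : V -> V -> R)
    (G : sgraph V) :
  (forall u v, 0 <= p u v <= 1) -> 0 <= graph_weight p G.
Proof.
move=> p01; apply: prodr_ge0 => e _; have /andP[p0 p1] := p01 e.1 e.2.
by case: ifP => // _; rewrite subr_ge0.
Qed.

Lemma graph_prob_ge0 (R : realType) (V : finType) (p : V -> V -> R)
    (A : pred (sgraph V)) :
  (forall u v, 0 <= p u v <= 1) -> 0 <= graph_prob p A.
Proof. by move=> p01; apply: sumr_ge0 => G _; exact: graph_weight_ge0. Qed.

Lemma graph_probC (R : realType) (V : finType) (p : V -> V -> R)
    (A : pred (sgraph V)) :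
  graph_prob p A = 1 - graph_prob p (fun G => ~~ A G).
Proof.
rewrite -(graph_probT p) /graph_prob [X in _ = X - _](bigID A) /=.
by rewrite addrK.
Qed.

Lemma graph_prob_union_bound (R : realType) (V I : finType) (p : V -> V -> R)
    (P : pred I) (A : pred (sgraph V)) (B : I -> pred (sgraph V)) :
  (forall u v, 0 <= p u v <= 1) ->
  (forall G, A G -> exists2 i, P i & B i G) ->
  graph_prob p A <= \sum_(i | P i) graph_prob p (B i).
Proof.
move=> p01 AB; rewrite /graph_prob (exchange_big_dep xpredT) //=.
rewrite big_mkcond; apply: ler_sum => G _.
case: ifPn => [/AB[i Pi Bi]|_]; last first.
  by apply: sumr_ge0 => *; exact: graph_weight_ge0.
rewrite (bigD1 i) /= ?Pi// lerDl.
by apply: sumr_ge0 => *; exact: graph_weight_ge0.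
Qed.

Lemma graph_prob_le (R : realType) (V : finType) (p : V -> V -> R)
    (A B : pred (sgraph V)) :
  (forall u v, 0 <= p u v <= 1) -> (forall G, A G -> B G) ->
  graph_prob p A <= graph_prob p B.
Proof.
move=> p01 AB.
(* Monotonicity is the union bound over a one-point index type. *)
have := @graph_prob_union_bound R V unit p xpredT A (fun=> B) p01.
by rewrite (big_pred1 tt) => [|[]]; [apply=> G /AB; exists tt|].
Qed.

Lemma adjC (V : finType) (G : sgraph V) (u v : V) : adj G u v = adj G v u.
Proof.
case: G => E sE; rewrite /adj /=; have /andP[_ symE] := sE.
by apply/eqP; exact: (forallP (forallP symE u) v).
Qed.

Lemma adj_irrefl (V : finType) (G : sgraph V) (u : V) : adj G u u = false.
Proof.
case: G => E sE; rewrite /adj /=; have /andP[/forallP irrE _] := sE.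
exact: negPf (irrE u).
Qed.

Lemma is_pair_total (V : finType) (u v : V) :
  u != v -> ~~ is_pair (u, v) -> is_pair (v, u).
Proof.
rewrite /is_pair /= -leqNgt leq_eqVlt => /negPf uv.
by case/orP=> [/eqP/val_inj/enum_rank_inj/esym/eqP|//]; rewrite uv.
Qed.

Lemma graph_prob_adj (R : realType) (V : finType) (p : V -> V -> R) (u v : V) :
  (forall x y, p x y = p y x) -> u != v ->
  graph_prob p (fun G => adj G u v) = p u v.
Proof.
move=> psym.
(* The edge law is stated for increasing pairs only; symmetry of [p] and of adjacency allows either
   orientation. *)
wlog uv : u v / is_pair (u, v) => [hw neq|_].
  have [/hw->//|/(is_pair_total _ _ _ neq)/hw] := boolP (is_pair (u, v)).
  rewrite eq_sym psym => <- //.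
  by rewrite /graph_prob; apply: eq_bigl => G; exact: adjC.
have := @graph_prob_edges R V p [set (u, v)]%SET.
rewrite big_set1 /= => <-; last by move=> e /set1P ->.
apply: eq_bigl => G; apply/idP/forall_inP => [uvG e /set1P -> //|].
by move=> /(_ (u, v) (set11 _)).
Qed.

(** * Empty cuts, disconnection and isolated vertices in a general random graph *)

Lemma graph_prob_cut (R : realType) (V : finType) (p : V -> V -> R) (q : R)
    (S : {set V}) :
  (forall u v, 0 <= p u v <= 1) -> 0 <= q ->
  (forall u v, u != v -> q <= p u v) ->
  graph_prob p (fun G => [forall u in S, forall v in ~: S, ~~ adj G u v])
    <= expR (- q) ^+ (#|S| * #|~: S|).
Proof.
move=> p01 q0 qp.
(* [F] gives weight 0 to a present edge across the cut, so the sum of its products dominates the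
   probability of an empty cut. After factorisation a non-crossing pair contributes
   [p + (1 - p) = 1] and a crossing one [1 - p <= 1 - q <= expR (- q)]. *)
pose crossing (e : V * V) := (e.1 \in S) != (e.2 \in S).
pose F (e : V * V) (b : bool) : R :=
  if b then (if crossing e then 0 else p e.1 e.2) else 1 - p e.1 e.2.
have F0 e b : 0 <= F e b.
  have /andP[? ?] := p01 e.1 e.2.
  by rewrite /F; case: b; rewrite ?subr_ge0//; case: ifP.
apply: (@le_trans _ _
    (\sum_(G : sgraph V) \prod_(e | is_pair e) F e (adj G e.1 e.2))).
  rewrite /graph_prob big_mkcond; apply: ler_sum => G _.
  case: ifPn => [/forall_inP SG|_]; last exact: prodr_ge0.
  apply: ler_prod => e _; have /andP[p0 p1] := p01 e.1 e.2.
  rewrite /F; case: ifP => [eG|_]; last by rewrite subr_ge0 p1 lexx.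
  case: ifPn => [|_]; last by rewrite p0 lexx.
  rewrite /crossing; case: (boolP (e.1 \in S)) => e1; case: (boolP (e.2 \in S)) => e2 // _.
    have /forall_inP/(_ e.2) := SG _ e1.
    by rewrite inE e2 eG => /(_ isT).
  have /forall_inP/(_ e.1) := SG _ e2.
  by rewrite inE e1 adjC eG => /(_ isT).
rewrite sum_prod_graph (bigID crossing) /= [X in _ * X]big1 ?mulr1; last first.
  by move=> e /andP[_ /negPf eS]; rewrite /F eS addrC subrK.
pose C := [set e : V * V | is_pair e && crossing e]%SET.
apply: (@le_trans _ _ (\prod_(e in C) expR (- q))).
  rewrite [leRHS](eq_bigl (fun e => is_pair e && crossing e)); last first.
    by move=> e; rewrite inE.
  apply: ler_prod => -[u v] /andP[uv cuv]; apply/andP; split.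
    exact: (addr_ge0 (F0 (u, v) true) (F0 (u, v) false)).
  rewrite /F cuv add0r (le_trans _ (expR_ge1Dx _))// lerD2l lerN2 qp//=.
  by apply: contraTneq uv => ->; rewrite /is_pair ltnn.
(* As [expR (- q) <= 1], a lower bound on the size of [C] suffices: putting the two ends in
   increasing order maps S x ~S injectively into [C]. *)
rewrite prodr_const ler_wiXn2l ?expR_ge0 ?expR_le1 ?oppr_le0//.
rewrite -cardsX.
pose ord_pair (e : V * V) := if is_pair e then e else (e.2, e.1).
have ordS e : e \in finset.setX S (~: S) -> ord_pair e \in C.
  case: e => u v; rewrite !inE /= => /andP[uS vS].
  have uv : u != v by apply: contraNneq vS => <-.
  rewrite /ord_pair /crossing; case: ifPn => [-> | /(is_pair_total _ _ _ uv) ->] /=.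
    by rewrite uS (negPf vS).
  by rewrite uS (negPf vS).
rewrite -(@card_in_imset _ _ ord_pair).
  by apply/subset_leq_card/fintype.subsetP => _ /imsetP[e /ordS ? ->].
move=> -[u v] -[u' v']; rewrite !inE /= => /andP[uS vS] /andP[uS' vS'].
rewrite /ord_pair; case: ifP; case: ifP => // _ _ [] // ? ?; subst.
- by rewrite uS' in vS.
- by rewrite uS' in vS.
- by [].
Qed.

(** No edge joins the component of a vertex to its complement, and both are nonempty when the graph
    is disconnected; one of them has at most half of the vertices. *)
Lemma disconnected_cut (V : finType) (G : sgraph V) :
  ~~ connected_graph G ->
  exists2 S : {set V}, (S != finset.set0) && (2 * #|S| <= #|V|)%N &
    [forall u in S, forall v in ~: S, ~~ adj G u v].
Proof.
case/forallPn=> u /forallPn[v uv].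
have csym : connect_sym (adj G).
  by apply: sym_connect_sym => x y; exact: adjC.
pose C := [set x | connect (adj G) u x]%SET.
have CG x y : x \in C -> y \notin C -> ~~ adj G x y.
  rewrite !inE => ux; apply: contra => xy.
  exact: connect_trans ux (connect1 xy).
have uC : u \in C by rewrite inE connect0.
have vC : v \notin C by rewrite inE.
have [CV|CV] := leqP (2 * #|C|) #|V|.
  exists C; first by rewrite CV andbT; apply/set0Pn; exists u.
  apply/forall_inP=> x xC; apply/forall_inP=> y; rewrite inE => yC.
  exact: CG.
exists (~: C).
  apply/andP; split; first by apply/set0Pn; exists v; rewrite inE.
  by move: CV; rewrite -(cardsC C) mul2n -addnn ltn_add2l mul2n -addnn leq_add2r => /ltnW.
apply/forall_inP=> x xC; apply/forall_inP=> y; rewrite finset.setCK => yC.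
by rewrite adjC CG//; move: xC; rewrite inE.
Qed.

Lemma graph_prob_disconnected_le (R : realType) (V : finType)
    (p : V -> V -> R) (q : R) :
  (forall u v, 0 <= p u v <= 1) -> 0 <= q ->
  (forall u v, u != v -> q <= p u v) ->
  graph_prob p (fun G => ~~ connected_graph G)
    <= expR (#|V|%:R * expR (- (q * #|V|%:R / 2))) - 1.
Proof.
move=> p01 q0 qp; set x := expR (- (q * _ / 2)).
have x0 : 0 < x by exact: expR_gt0.
(* The complement of [S] has at least half of the vertices, which is where the 2 in [x] comes
   from. *)
have cut (S : {set V}) : (2 * #|S| <= #|V|)%N ->
    expR (- q) ^+ (#|S| * #|~: S|) <= x ^+ #|S|.
  move=> SV; rewrite mulnC exprM lerXn2r ?nnegrE ?exprn_ge0 ?expR_ge0//.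
  rewrite -expRM_natl ler_expR mulrN lerN2 -mulrA [leRHS]mulrC.
  rewrite ler_wpM2l// ler_pdivrMr// -natrM ler_nat.
  by move: SV; rewrite -(cardsC S); lia.
apply: (@le_trans _ _ (\sum_(S : {set V} | S != finset.set0) x ^+ #|S|)).
  apply: le_trans (graph_prob_union_bound _ _ _ _ _ _ _ p01 (@disconnected_cut V)) _.
  rewrite [leLHS]big_mkcond [leRHS]big_mkcond; apply: ler_sum => S _.
  case: ifP => [/andP[-> SV]|_].
    exact: le_trans (graph_prob_cut _ _ _ _ _ p01 q0 qp) (cut _ SV).
  by case: ifP => // _; rewrite exprn_ge0// ltW.
(* Expanding the product of the [x + 1] over all vertices gives one term per subset; the empty set
   accounts for the 1 subtracted. *)
have -> : \sum_(S : {set V} | S != finset.set0) x ^+ #|S| = (1 + x) ^+ #|V| - 1.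
  have -> : (1 + x) ^+ #|V| = \prod_(u : V) (x + 1) by rewrite prodr_const addrC.
  rewrite bigA_distr [in RHS](bigD1 finset.set0) //=.
  rewrite [X in X + _ - 1]big1 => [|i _]; last by rewrite finset.in_set0.
  rewrite addrAC subrr add0r; apply: eq_bigr => S _.
  rewrite -big_mkcond /= prodr_const //.
rewrite lerD2r expRM_natl lerXn2r ?nnegrE ?addr_ge0 ?expR_ge0 ?(ltW x0)//.
exact: expR_ge1Dx.
Qed.

(** Markov's inequality in multiplied form: on the event more than [c] vertices are not isolated,
    and by the union bound a vertex is not isolated with probability at most its expected degree. *)
Lemma markov_isolated (R : realType) (V : finType) (p : V -> V -> R) (c : R) :
  (forall u v, 0 <= p u v <= 1) -> (forall u v, p u v = p v u) ->
  c * graph_prob p (fun G => #|isolated_vertices G|%:R < #|V|%:R - c)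
    <= \sum_u \sum_(v | v != u) p u v.
Proof.
move=> p01 psym.
apply: (@le_trans _ _
  (\sum_u graph_prob p (fun G => u \notin isolated_vertices G))).
  rewrite /graph_prob mulr_sumr (exchange_big_dep xpredT) //=.
  rewrite big_mkcond; apply: ler_sum => G _.
  have w0 := graph_weight_ge0 _ _ p G p01.
  case: ifP => [iso|_]; last by apply: sumr_ge0.
  rewrite sumr_const -mulr_natl ler_wpM2r//.
  rewrite -(cardsC (isolated_vertices G)) natrD in iso.
  have -> : #|[pred u | u \notin isolated_vertices G]| = #|~: isolated_vertices G|.
    by apply: eq_card => u; rewrite !inE.
  by lra.
apply: ler_sum => u _.
under eq_bigr => v vu do rewrite -graph_prob_adj 1?eq_sym//.
apply: graph_prob_union_bound => // G.
rewrite inE => /forallPn[v]; rewrite negbK => uv; exists v => //.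
by apply: contraTneq uv => ->; rewrite adj_irrefl.
Qed.

(** * Real estimates: negative powers, exponential decay and harmonic sums *)

Lemma natr_powRN_cvg0 (R : realType) (a : R) :
  0 < a -> (n%:R `^ (- a) @[n --> \oo] --> 0)%classic.
Proof.
(* The threshold [eps]^ (- a^-1)[is the solution]t[of]t [^ (- a) = eps]. *)
move=> a0; apply/cvgr0Pnorm_lt => eps eps0; near=> n.
have en : eps `^ (- a^-1) < n%:R by near: n; exact: nbhs_infty_gtr.
have n0 : 0 < n%:R :> R by apply: le_lt_trans en; exact: powR_ge0.
rewrite ger0_norm ?powR_ge0// powRN invf_plt ?posrE ?powR_gt0//.
have -> : eps^-1 = (eps `^ (- a^-1)) `^ a.
  by rewrite -powRrM mulNr mulVf ?gt_eqF// powRN powRr1// ltW.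
by apply: gt0_ltr_powR; rewrite // nnegrE ?powR_ge0// ltW.
Unshelve. all: by end_near. Qed.

(** A single term of the exponential series bounds [expR y] from below; this trades exponential
    decay for an arbitrarily high negative power of [y]. *)
Lemma expRN_le (R : realType) (k : nat) (y : R) :
  0 < y -> expR (- y) <= (k.+1)`!%:R / y ^+ k.+1.
Proof.
move=> y0; rewrite expRN invf_ple ?posrE ?expR_gt0//; last first.
  by rewrite divr_gt0 ?exprn_gt0// ltr0n fact_gt0.
rewrite invf_div (le_trans _ (expR_ge1Dxn k (ltW y0)))//.
by rewrite lerDr.
Qed.

(** The term [d = 0] vanishes since 0^-1 = 0, so the sum is the harmonic number of [n.+1]. The
    induction step is ln(1 - 1/(n+2)) <= -1/(n+2). *)
Lemma harmonic_sum_le (R : realType) (n : nat) :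
  \sum_(d < n.+2) (d%:R : R)^-1 <= 1 + ln n.+1%:R.
Proof.
elim: n => [|n IH]; first by rewrite !big_ord_recr big_ord0 /= invr0 ln1; lra.
rewrite big_ord_recr /= (le_trans (lerD IH (lexx _)))// -addrA lerD2l.
have n2 : 0 < n.+2%:R :> R by [].
have lt : -1 < - n.+2%:R^-1 :> R by rewrite ltrN2 invf_lt1// ltr1n.
have := le_ln1Dx lt.
have -> : 1 - n.+2%:R^-1 = n.+1%:R / n.+2%:R :> R.
  apply: (mulIf (lt0r_neq0 n2)); rewrite mulrBl mulVf ?divfK ?lt0r_neq0//.
  by rewrite mul1r -(natr1 n.+1) addrK.
by rewrite ln_div ?posrE//; move: (ln _) (ln _) (_^-1) => x y z; lra.
Qed.

(** The logarithm is absorbed into a small power: a ln n = ln(n^a) < n^a, and 1 <= n^a covers the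
    constant. *)
Lemma harmonic_sum_le_powR (R : realType) (a : R) (n : nat) :
  0 < a -> (0 < n)%N ->
  \sum_(d < n) (d%:R : R)^-1 <= (1 + a^-1) * n%:R `^ a.
Proof.
case: n => // n a0 _; have n0 : 0 < n.+1%:R :> R by [].
have n1 : 1 <= n.+1%:R `^ a :> R.
  by rewrite -[leLHS](powRr0 n.+1%:R) ler_powR ?ler1n// ltW.
apply: (@le_trans _ _ (1 + ln n.+1%:R)).
  by apply: le_trans (harmonic_sum_le _ _); rewrite [leRHS]big_ord_recr /= lerDl invr_ge0.
have : ln n.+1%:R <= a^-1 * n.+1%:R `^ a :> R.
  rewrite mulrC ler_pdivlMr// mulrC -ln_powR.
  by apply/ltW/ln_sublinear; rewrite powR_gt0.
by rewrite mulrDl mul1r; lra.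
Qed.

(** Subtraction is truncated, so the terms with [j <= a] are 0^-1 = 0; the remaining ones, shifted
    by [a], form an initial segment of the harmonic sum. *)
Lemma sum_inv_subn_le (R : realType) (n a : nat) :
  \sum_(j < n) ((j - a)%N%:R : R)^-1 <= \sum_(d < n) (d%:R : R)^-1.
Proof.
have inv0 (k : nat) : 0 <= (k%:R : R)^-1 by rewrite invr_ge0.
rewrite -(big_mkord xpredT (fun j => ((j - a)%N%:R)^-1)).
rewrite -(big_mkord xpredT (fun j => (j%:R)^-1)).
have [na|an] := leqP n a.
  rewrite big_nat big1 ?sumr_ge0// => j /andP[_ jn].
  by rewrite (_ : (j - a = 0)%N) ?invr0//; lia.
rewrite (big_cat_nat (leq0n a) (ltnW an)) /= big_nat big1 ?add0r; last first.
  by move=> j /andP[_ ja]; rewrite (_ : (j - a = 0)%N) ?invr0//; lia.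
rewrite -{1}[a]add0n big_addn.
under eq_bigr do rewrite addnK.
rewrite [leRHS](@big_cat_nat _ _ _ (n - a)) ?leq_subr//=.
by rewrite lerDl sumr_ge0.
Qed.

Lemma sum_inv_distn_le (R : realType) (n : nat) (a : 'I_n) :
  \sum_(j < n) (`|(a : nat)%:Z - (j : nat)%:Z|%N%:R : R)^-1
    <= 2 * \sum_(d < n) (d%:R : R)^-1.
Proof.
rewrite mulr_natl mulr2n.
(* The indices above [a] are counted by the second sum, and those below, after the reflection j ->
   n-1-j, by the first; truncation makes the other summand zero each time. *)
have -> : \sum_(j < n) (`|(a : nat)%:Z - (j : nat)%:Z|%N%:R : R)^-1 =
    \sum_(j < n) ((j - (n.-1 - a))%N%:R : R)^-1 +
    \sum_(j < n) ((j - a)%N%:R : R)^-1.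
  rewrite [X in _ = X + _](reindex_inj rev_ord_inj) /= -big_split /=.
  apply: eq_bigr => j _.
  have [aj|ja] := leqP a j.
    rewrite (_ : (n - j.+1 - (n.-1 - a) = 0)%N); last by lia.
    by rewrite invr0 add0r distnEr.
  rewrite (_ : (j - a = 0)%N) ?invr0 ?addr0; last by lia.
  rewrite distnEl; last exact: ltnW.
  congr (_%:R^-1); have := ltn_ord a; lia.
by apply: lerD; exact: sum_inv_subn_le.
Qed.

(** * Sums and distances over the lattice box *)

Lemma sum_lattice_coord (R : realType) (r n : nat) (i : 'I_r) (F : 'I_n -> R) :
  \sum_(v : lattice_box r n) F (v i) = n%:R ^+ r.-1 * \sum_j F j.
Proof.
(* Trivial factors at the coordinates other than [i] turn the summand into a product, so the sum
   over the box factorises; each free coordinate gives a factor [n]. *)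
pose G (k : 'I_r) (j : 'I_n) : R := if k == i then F j else 1.
transitivity (\sum_(v : lattice_box r n) \prod_k G k (v k)).
  apply: eq_bigr => v _; rewrite (bigD1 i) //= /G eqxx big1 ?mulr1//.
  by move=> k /negPf ->.
rewrite -bigA_distr_bigA (bigD1 i) //= mulrC; congr (_ * _); last first.
  by apply: eq_bigr => j _; rewrite /G eqxx.
rewrite (eq_bigr (fun=> n%:R)) => [|k /negPf ki]; last first.
  rewrite /G (eq_bigr (fun=> 1)) => [|j _]; last by rewrite ki.
  by rewrite sumr_const card_ord.
by rewrite prodr_const (cardC1 i) card_ord.
Qed.

Lemma l1_dist_ge (r n : nat) (u v : lattice_box r n) (i : 'I_r) :
  (`|(u i : nat)%:Z - (v i : nat)%:Z| <= l1_dist u v)%N.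
Proof. by rewrite /l1_dist (bigD1 i) //= leq_addr. Qed.

Lemma lattice_neq (r n : nat) (u v : lattice_box r n) :
  v != u -> exists i, (0 < `|(u i : nat)%:Z - (v i : nat)%:Z|)%N.
Proof.
move=> vu; apply/existsP; apply: contraNT vu => /existsPn uv.
apply/eqP/ffunP => i; apply: val_inj => /=.
by have := uv i; rewrite lt0n negbK distn_eq0 => /eqP[].
Qed.

Lemma l1_dist_gt0 (r n : nat) (u v : lattice_box r n) :
  v != u -> (0 < l1_dist u v)%N.
Proof. by move=> /lattice_neq[i /leq_trans]; apply; exact: l1_dist_ge. Qed.

Lemma l1_dist_le (r n : nat) (u v : lattice_box r n) : (l1_dist u v <= r * n)%N.
Proof.
rewrite -[r in leqRHS]card_ord -sum_nat_const; apply: leq_sum => i _.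
by have := ltn_ord (u i); have := ltn_ord (v i); lia.
Qed.

Lemma sum_inv_l1_dist_le (R : realType) (r n : nat) (u : lattice_box r n) :
  \sum_(v | v != u) ((l1_dist u v)%:R : R)^-1
    <= r%:R * n%:R ^+ r.-1 * (2 * \sum_(d < n) (d%:R : R)^-1).
Proof.
pose g i (j : 'I_n) : R := (`|(u i : nat)%:Z - (j : nat)%:Z|%N%:R)^-1.
have g0 i j : 0 <= g i j by rewrite invr_ge0.
(* Since 0^-1 = 0, the coordinates where u and v agree contribute nothing. *)
apply: (@le_trans _ _ (\sum_(v : lattice_box r n) \sum_i g i (v i))).
  rewrite [leLHS]big_mkcond; apply: ler_sum => v _.
  case: ifP => [/[dup] vu /lattice_neq[i uvi]|_]; last exact: sumr_ge0.
  rewrite (bigD1 i) //= (@le_trans _ _ (g i (v i)))//; last first.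
    by rewrite lerDl sumr_ge0.
  by rewrite lef_pV2 ?posrE ?ltr0n ?l1_dist_gt0// ler_nat l1_dist_ge.
rewrite exchange_big /= -mulrA mulr_natl -[X in _ *+ X]card_ord -sumr_const.
apply: ler_sum => i _; rewrite sum_lattice_coord ler_wpM2l ?exprn_ge0//.
exact: sum_inv_distn_le.
Qed.

Lemma card_lattice_box (r n : nat) : #|lattice_box r n| = (n ^ r)%N.
Proof. by rewrite card_ffun !card_ord. Qed.

Lemma inv_dist_fun_ge0 (R : realType) (beta : R) (n d : nat) :
  0 <= inv_dist_fun beta n d.
Proof. by rewrite /inv_dist_fun invr_ge0 mulr_ge0 ?powR_ge0. Qed.

Lemma lattice_edge_prob01 (R : realType) (r : nat) (beta : R) (n : nat)
    (u v : lattice_box r n) :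
  0 <= edge_prob (@l1_dist r n) (inv_dist_fun beta n) u v <= 1.
Proof. by rewrite /edge_prob le_min ler01 inv_dist_fun_ge0 ge_min lexx. Qed.

(** * Proving and transferring asymptotically almost sure statements *)

Lemma aas_of_le (R : realType) (r : nat) (beta : R)
    (A : forall n, pred (sgraph (lattice_box r n))) (e : nat -> R) :
  (forall n, (0 < n)%N -> lattice_prob beta (fun G => ~~ A n G) <= e n) ->
  (e @ \oo --> (0 : R))%classic -> aas beta A.
Proof.
move=> Ae e0; rewrite /aas.
apply: (@squeeze_cvgr _ _ _ _ (fun n => 1 - e n) (fun=> 1)); last first.
- exact: cvg_cst.
- by rewrite -[X in (_ --> X)%classic]subr0; apply: cvgB => //; exact: cvg_cst.
near=> n; rewrite /lattice_prob graph_probC.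
have n0 : (0 < n)%N by near: n; exact: nbhs_infty_gt.
rewrite lerD2l lerN2 Ae//= gerBl; apply: graph_prob_ge0 => u v.
exact: lattice_edge_prob01.
Unshelve. all: by end_near. Qed.

(** Small [n] is exempted because a box with a single vertex is connected although that vertex is
    isolated. *)
Lemma aas_mono (R : realType) (r : nat) (beta : R)
    (A B : forall n, pred (sgraph (lattice_box r n))) :
  (forall n G, (1 < n)%N -> A n G -> B n G) -> aas beta A -> aas beta B.
Proof.
rewrite /aas => AB cvgA; apply: (@squeeze_cvgr _ _ _ _
  (fun n => lattice_prob beta (A n)) (fun=> 1)) => //; last exact: cvg_cst.
near=> n; have n1 : (1 < n)%N by near: n; exact: nbhs_infty_gt.
have p01 := @lattice_edge_prob01 R r beta n.
rewrite /lattice_prob graph_prob_le//=; last by move=> G; exact: AB.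
by rewrite graph_probC gerBl graph_prob_ge0.
Unshelve. all: by end_near. Qed.

(** * Connectedness for beta < r - 1 *)

Lemma lattice_connected_aas (R : realType) (r : nat) (beta : R) :
  (0 < r)%N -> beta < r%:R - 1 ->
  aas beta (fun n (G : sgraph (lattice_box r n)) => connected_graph G).
Proof.
(* [eps] serves both cases of the minimum in [q] below: q n^r is n^r if q = 1, and n^(r-1-beta)/r
   otherwise, hence at least n^eps/r. *)
move=> r0 beta_r; pose eps : R := Num.min r%:R (r%:R - 1 - beta).
have eps0 : 0 < eps by rewrite lt_min ltr0n r0 subr_gt0.
(* [k] makes eps (k+1) exceed r + 1, so that n^r times n^(-eps (k+1)) is at most 1/n; [C] collects
   the constants of [expRN_le] at y = n^eps/(2r). *)
pose k := Num.truncn ((r%:R + 1) / eps).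
have kP : r%:R - eps * k.+1%:R <= -1.
  have : (r%:R + 1) / eps < k.+1%:R by rewrite truncnS_gt.
  by rewrite ltr_pdivrMr// mulrC; lra.
pose C : R := (k.+1)`!%:R * (2 * r%:R) ^+ k.+1.
have C0 : 0 <= C by rewrite mulr_ge0 ?exprn_ge0 ?mulr_ge0.
have rR0 : 0 < r%:R :> R by rewrite ltr0n.
apply: (@aas_of_le _ _ _ _ (fun n => expR (C * n%:R `^ (- 1)) - 1)); last first.
  rewrite -[X in (_ --> X)%classic](subrr 1); apply: cvgB; last exact: cvg_cst.
  rewrite -[X in (_ --> X)%classic]expR0; apply: continuous_cvg; first exact: continuous_expR.
  rewrite -[X in (_ --> X)%classic](mulr0 C); apply: cvgM; first exact: cvg_cst.
  exact: natr_powRN_cvg0.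
move=> n n0; have nR0 : 0 < n%:R :> R by rewrite ltr0n.
have n_neq0 : (n%:R : R) != 0 by rewrite gt_eqF.
have n1 : 1 <= n%:R :> R by rewrite ler1n.
pose q : R := Num.min 1 (inv_dist_fun beta n (r * n)).
have q0 : 0 <= q by rewrite le_min ler01 inv_dist_fun_ge0.
apply: le_trans (@graph_prob_disconnected_le _ _ _ q _ q0 _) _.
- exact: lattice_edge_prob01.
- move=> u v uv; rewrite /q /edge_prob le_min ge_min lexx /=.
  rewrite ge_min; apply/orP; right.
  have d0 : (0 < l1_dist u v)%N by rewrite l1_dist_gt0// eq_sym.
  rewrite lef_pV2 ?posrE ?mulr_gt0 ?powR_gt0 ?ltr0n ?muln_gt0 ?r0//.
  by rewrite ler_pM2l ?powR_gt0// ler_nat l1_dist_le.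
rewrite lerD2r ler_expR card_lattice_box natrX.
pose y : R := n%:R `^ eps / (2 * r%:R).
have y0 : 0 < y by rewrite divr_gt0 ?powR_gt0 ?mulr_gt0.
have yq : y <= q * n%:R ^+ r / 2.
  rewrite /y invfM mulrA mulrAC ler_pM2r//.
  rewrite -powR_mulrn ?(ltW nR0)// /q; case: (leP 1 (inv_dist_fun _ _ _)) => _.
    rewrite mul1r (@le_trans _ _ (n%:R `^ eps))//.
      by rewrite ler_pdivrMr// ler_peMr ?powR_ge0// ler1n.
    by rewrite ler_powR// ge_min lexx.
  have -> : inv_dist_fun beta n (r * n) = n%:R `^ (- beta - 1) / r%:R.
    rewrite /inv_dist_fun natrM !invfM powRB ?n_neq0 ?implybT// powRN.
    by rewrite powRr1 ?(ltW nR0)// mulrA mulrAC.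
  rewrite mulrAC -powRD ?n_neq0 ?implybT// ler_pM2r ?invr_gt0// ler_powR//.
  by rewrite ge_min; apply/orP; right; lra.
apply: (@le_trans _ _ (n%:R ^+ r * expR (- y))).
  by rewrite ler_wpM2l ?exprn_ge0// ler_expR lerN2.
apply: (@le_trans _ _ (n%:R ^+ r * ((k.+1)`!%:R / y ^+ k.+1))).
  by rewrite ler_wpM2l ?exprn_ge0// expRN_le.
have -> : n%:R ^+ r * ((k.+1)`!%:R / y ^+ k.+1) =
    C * n%:R `^ (r%:R - eps * k.+1%:R).
  rewrite powRB ?n_neq0 ?implybT// powRrM !powR_mulrn ?powR_ge0 ?(ltW nR0)//.
  rewrite /C /y expr_div_n invf_div.
  by rewrite mulrCA mulrA [in RHS]mulrACA [in RHS]mulrA -!mulrA; congr (_ * _); rewrite mulrCA.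
by rewrite ler_wpM2l// ler_powR.
Qed.

(** * Isolated vertices and disconnectedness for beta > r - 1 *)

Lemma lattice_degree_le (R : realType) (r : nat) (beta a : R) (n : nat)
    (u : lattice_box r n) :
  (0 < r)%N -> (0 < n)%N -> 0 < a ->
  \sum_(v | v != u) edge_prob (@l1_dist r n) (inv_dist_fun beta n) u v
    <= 2 * r%:R * (1 + a^-1) * n%:R `^ (r%:R - 1 - beta + a).
Proof.
move=> r0 n0 a0; have nR0 : 0 < n%:R :> R by rewrite ltr0n.
have n_neq0 : (n%:R : R) != 0 by rewrite gt_eqF.
apply: (@le_trans _ _ (n%:R `^ (- beta) *
    \sum_(v | v != u) ((l1_dist u v)%:R : R)^-1)).
  rewrite mulr_sumr; apply: ler_sum => v _.
  by rewrite /edge_prob ge_min /inv_dist_fun invfM powRN lexx orbT.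
apply: le_trans (ler_wpM2l (powR_ge0 _ _) (sum_inv_l1_dist_le _ _ _ u)) _.
(* The exponent has three sources: the scaling n^(-beta), the r - 1 free coordinates, and the [a]
   that pays for the harmonic sum. *)
have -> : r%:R - 1 - beta + a = - beta + r.-1%:R + a.
  by rewrite -[in LHS](prednK r0) -natr1; lra.
rewrite !powRD ?n_neq0 ?implybT// powR_mulrn ?(ltW nR0)//.
have hb := @harmonic_sum_le_powR R a n a0 n0.
set H := \sum_(d < n) _ in hb *.
have := ler_wpM2l (_ : 0 <= 2 * (n%:R `^ (- beta) * (r%:R * n%:R ^+ r.-1))) hb.
rewrite !mulr_ge0 ?powR_ge0 ?exprn_ge0// => /(_ isT).
by congr (_ <= _); ring.
Qed.

Lemma lattice_isolated_aas (R : realType) (r : nat) (beta : R) :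
  (0 < r)%N -> r%:R - 1 < beta ->
  aas beta (fun n (G : sgraph (lattice_box r n)) =>
    n%:R ^+ r * (1 - n%:R `^ (- ((beta - (r%:R - 1)) / 4)))
      <= #|isolated_vertices G|%:R).
Proof.
(* Since beta - (r - 1) = 4a, spending 2a on the harmonic sum leaves expected degrees of order
   n^(-2a). Allowing c = n^(r-a) non-isolated vertices then leaves failure probability of order
   n^(-a). *)
move=> r0 beta_r; set a := (beta - (r%:R - 1)) / 4.
have a0 : 0 < a by rewrite divr_gt0// subr_gt0.
pose C : R := 2 * r%:R * (1 + (2 * a)^-1).
apply: (@aas_of_le _ _ _ _ (fun n => C * n%:R `^ (- a))); last first.
  rewrite -[X in (_ --> X)%classic](mulr0 C); apply: cvgM; first exact: cvg_cst.
  exact: natr_powRN_cvg0.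
move=> n n0; have nR0 : 0 < n%:R :> R by rewrite ltr0n.
have n_neq0 : (n%:R : R) != 0 by rewrite gt_eqF.
pose c : R := n%:R ^+ r * n%:R `^ (- a).
have c0 : 0 < c by rewrite mulr_gt0 ?exprn_gt0 ?powR_gt0.
rewrite -(ler_pM2l c0).
have deg : \sum_(u : lattice_box r n) \sum_(v | v != u)
    edge_prob (@l1_dist r n) (inv_dist_fun beta n) u v
      <= c * (C * n%:R `^ (- a)).
  apply: (@le_trans _ _ (\sum_(u : lattice_box r n) C * n%:R `^ (- (2 * a)))).
    apply: ler_sum => u _.
    have a2 : 0 < 2 * a by rewrite mulr_gt0.
    have := @lattice_degree_le R r beta (2 * a) n u r0 n0 a2.
    by rewrite (_ : r%:R - 1 - beta + 2 * a = - (2 * a)) // /a; lra.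
  rewrite sumr_const card_lattice_box -[leLHS]mulr_natl natrX.
  rewrite (_ : - (2 * a) = - a + - a); last by lra.
  by rewrite powRD ?n_neq0 ?implybT// /c; nra.
apply: le_trans deg.
have := @markov_isolated R (lattice_box r n)
  (edge_prob (@l1_dist r n) (inv_dist_fun beta n)) c
  (@lattice_edge_prob01 R r beta n).
have psym (u v : lattice_box r n) :
    edge_prob (@l1_dist r n) (inv_dist_fun beta n) u v =
    edge_prob (@l1_dist r n) (inv_dist_fun beta n) v u.
  by rewrite /edge_prob l1_distC.
move=> /(_ psym); apply: le_trans; rewrite ler_wpM2l ?(ltW c0)//.
apply: graph_prob_le => [u v|G]; first exact: lattice_edge_prob01.
by rewrite -ltNge card_lattice_box natrX mulrBr mulr1.
Qed.

Lemma isolated_disconnected (V : finType) (G : sgraph V) (u : V) :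
  (1 < #|V|)%N -> u \in isolated_vertices G -> ~~ connected_graph G.
Proof.
move=> V1; rewrite inE => /forallP iso.
have /card_gt0P[v] : (0 < #|predC1 u|)%N by rewrite cardC1; case: #|V| V1 => [|[]].
rewrite inE => vu; apply/forallPn; exists u; apply/forallPn; exists v.
apply/connectP => -[[|w s]] /=; first by move=> _ /esym uv; rewrite uv eqxx in vu.
by rewrite (negPf (iso w)).
Qed.

(** For n > 1 the exceptional fraction n^(-a) is below 1, so the lower bound on the number of
    isolated vertices is positive and at least one exists. *)
Lemma lattice_disconnected_aas (R : realType) (r : nat) (beta : R) :
  (0 < r)%N -> r%:R - 1 < beta ->
  aas beta (fun n (G : sgraph (lattice_box r n)) => ~~ connected_graph G).
Proof.
move=> r0 beta_r; apply: aas_mono (lattice_isolated_aas _ _ _ r0 beta_r) => n G n1 iso.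
have nR1 : 1 < n%:R :> R by rewrite ltr1n.
have h1 : n%:R `^ (- ((beta - (r%:R - 1)) / 4)) < 1 :> R.
  set a := (beta - (r%:R - 1)) / 4.
  have a0 : 0 < a by rewrite divr_gt0// subr_gt0.
  rewrite powRN invf_lt1 ?powR_gt0//; last by lra.
  rewrite -[ltLHS](_ : 1 `^ a = 1); last by rewrite powR1.
  by apply: gt0_ltr_powR => //; rewrite nnegrE; lra.
have : 0 < #|isolated_vertices G|%:R :> R.
  by apply: lt_le_trans iso; rewrite mulr_gt0 ?subr_gt0// exprn_gt0//; lra.
rewrite ltr0n => /card_gt0P[u /isolated_disconnected]; apply.
by rewrite card_lattice_box -(exp1n r) ltn_exp2r.
Qed.

Local Open Scope classical_set_scope.


Theorem theorem4 (R : realType) (r : nat) (hr : (0 < r)%N) (beta : R) :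
  (beta < r%:R - 1 ->
     aas beta (fun n (G : sgraph (lattice_box r n)) => connected_graph G)) /\
  (r%:R - 1 < beta ->
     aas beta (fun n (G : sgraph (lattice_box r n)) => ~~ connected_graph G) /\
     exists h : nat -> R,
       h @ \oo --> (0 : R) /\
       aas beta (fun n (G : sgraph (lattice_box r n)) =>
         n%:R ^+ r * (1 - h n) <= #|isolated_vertices G|%:R)).
Proof.
split=> [|beta_r]; first exact: lattice_connected_aas.
split; first exact: lattice_disconnected_aas.
exists (fun n => n%:R `^ (- ((beta - (r%:R - 1)) / 4))); split.
  by apply: natr_powRN_cvg0; rewrite divr_gt0// subr_gt0.
exact: lattice_isolated_aas.
Qed.
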